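(* Let $d\geq 1$, $m\geq 3$ and $s=2d+3$, and let $n$ be a positive multiple of $s$. Let $0\leq \ell<n$ and let $X=C_m\Box^{\sigma_\ell} C_n$ be the Cartesian graph bundle with base $C_m$, fibre $C_n$ and cyclic $\ell$-shift $\sigma_\ell$. Suppose that one of the following holds: (a) $\ell=[ks+(-1)^a 2dm]\bmod n$ for some $a\in\{1,2\}$ and $k\in\mathbb{Z}$; (b) $d=3t+2$ for some integer $t\geq 0$, and $\ell=[ks-(2t+3)(d+a)m]\bmod n$ for some $a\in\{1,2\}$ and $k\in\mathbb{Z}$; (c) $d=3t+1$ for some integer $t\geq 0$, and $\ell=[ks+(2t+1)(d+a)m]\bmod n$ for some $a\in\{1,2\}$ and $k\in\mathbb{Z}$; (d) $d=3t$ for some integer $t\geq 1$, $m=ps+3t'$ for some integer $p\geq 0$ and some $t'\in\{0,1,\dots,2t\}$, and $\ell=\left[ks+(r+a-1)\frac{s}{3}-(-1)^a t'\right]\bmod n$ for some $a\in\{1,2\}$, $k\in\mathbb{Z}$ and $r\in\{0,1,2\}$. Then $\lambda^d_1(X)\leq 2d+2$, and $\lambda^d_1(X)=2d+2$ if $1\leq d\leq 4$.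
   Context: For $n\geq 3$, the cycle $C_n$ has vertex set $\{0,1,\dots,n-1\}$ with $i$ adjacent to $j$ iff $i\equiv j\pm 1 \pmod n$. The cyclic $\ell$-shift is the automorphism $\sigma_\ell(j)=(j+\ell)\bmod n$ of $C_n$. The Cartesian graph bundle $C_m\Box^{\sigma_\ell}C_n$ has vertex set $\{0,\dots,m-1\}\times\{0,\dots,n-1\}$; for every $i$ and every edge $j_1j_2$ of $C_n$, $(i,j_1)$ and $(i,j_2)$ are adjacent; for $0\leq i\leq m-2$ and every $j$, $(i,j)$ and $(i+1,j)$ are adjacent; and for every $j$, $(m-1,j)$ and $(0,\sigma_\ell(j))$ are adjacent; there are no other edges. (For $\ell=0$ this is the Cartesian product $C_m\Box C_n$.) For an integer $d\geq 1$, an $L(d,1)$-labeling of a graph $G$ is a map $f:V(G)\to\{0,1,2,\dots\}$ such that $|f(u)-f(v)|\geq d$ whenever $u,v$ are adjacent and $|f(u)-f(v)|\geq 1$ whenever $u,v$ are at distance $2$ in $G$. $\lambda^d_1(G)$ is the least $\lambda$ such that $G$ admits an $L(d,1)$-labeling with labels in $\{0,1,\dots,\lambda\}$. *)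

(* Defs.v *)
From mathcomp Require Import all_boot all_order all_algebra.
Set Implicit Arguments.
Unset Strict Implicit.
Unset Printing Implicit Defensive.

Record sgraph := SGraph {
  vertex :> finType;
  adj : rel vertex;
  adj_sym : symmetric adj;
  adj_irrefl : irreflexive adj }.

Definition simple_rel (T : finType) (e : rel T) : rel T :=
  fun x y => (x != y) && (e x y || e y x).

Fact simple_rel_sym (T : finType) (e : rel T) : symmetric (simple_rel e).
Proof. by move=> x y; rewrite /simple_rel eq_sym orbC. Qed.

Fact simple_rel_irrefl (T : finType) (e : rel T) : irreflexive (simple_rel e).
Proof. by move=> x; rewrite /simple_rel eqxx. Qed.

(* The simple graph with edges {x, y} for e x y: e may list an edge in one
   direction only, and its loops are dropped.  The relations used below have no
   loops when m, n >= 3, see cycle_edge_irrefl and bundle_edge_irrefl. *)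
Definition simple_graph_of (T : finType) (e : rel T) : sgraph :=
  SGraph (simple_rel_sym e) (simple_rel_irrefl e).

(* i = j - 1 mod n is written i + 1 = j mod n, as subtraction is truncated. *)
Definition cycle_edge (n : nat) : rel 'I_n :=
  fun i j => (i == j + 1 %[mod n]) || (i + 1 == j %[mod n]).

Definition cycle_graph (n : nat) : sgraph := simple_graph_of (@cycle_edge n).

Fact ord_size_gt0 (n : nat) (j : 'I_n) : 0 < n.
Proof. exact: leq_ltn_trans (ltn_ord j). Qed.

Definition cyclic_shift (n l : nat) (j : 'I_n) : 'I_n :=
  Ordinal (ltn_pmod (j + l) (ord_size_gt0 j)).

(* Edges inside a fibre, edges between consecutive fibres, and edges from the
   last fibre back to the first one, twisted by phi. *)
Definition bundle_edge (m n : nat) (phi : 'I_n -> 'I_n) : rel ('I_m * 'I_n) :=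
  fun u v =>
    [|| (u.1 == v.1) && @adj (cycle_graph n) u.2 v.2,
        (u.1.+1 == v.1 :> nat) && (u.2 == v.2)
      | [&& u.1 == m.-1 :> nat, v.1 == 0 :> nat & v.2 == phi u.2]].

Definition cycle_bundle (m n : nat) (phi : 'I_n -> 'I_n) : sgraph :=
  simple_graph_of (@bundle_edge m n phi).

Fact cycle_edge_irrefl (n : nat) : 1 < n -> irreflexive (@cycle_edge n).
Proof.
move=> n1 i; rewrite /cycle_edge eq_sym orbb -[X in _ == X %[mod _]]addn0.
by rewrite eqn_modDl mod0n modn_small.
Qed.

Fact bundle_edge_irrefl (m n : nat) (phi : 'I_n -> 'I_n) :
  1 < m -> irreflexive (@bundle_edge m n phi).
Proof.
case: m => [|[|m]] // _ u.
rewrite /bundle_edge adj_irrefl andbF -(addn1 u.1) -{2}(addn0 u.1) eqn_add2l /=.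
by case: eqP => [->|].
Qed.

Definition walk (G : sgraph) (k : nat) (u v : G) : bool :=
  [exists p : k.-tuple G, path (@adj G) u p && (last u p == v)].

Definition at_distance (G : sgraph) (k : nat) (u v : G) : bool :=
  walk k u v && [forall j : 'I_k, ~~ walk j u v].

Definition Ld1_labeling (G : sgraph) (d : nat) (f : G -> nat) : bool :=
  [forall u : G, forall v : G,
     (adj u v ==> (d <= `|f u - f v|)) &&
     (at_distance 2 u v ==> (1 <= `|f u - f v|))].

Definition has_Ld1_labeling (G : sgraph) (d k : nat) : bool :=
  [exists f : {ffun G -> 'I_k.+1}, Ld1_labeling d (fun v => f v)].

Fact has_Ld1_labeling_ex (G : sgraph) (d : nat) :
  exists k, has_Ld1_labeling G d k.
Proof.
pose g (v : G) := d.+1 * enum_rank v; exists (d.+1 * #|G|).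
have gP v : g v < (d.+1 * #|G|).+1 by rewrite ltnS leq_mul2l ltnW ?orbT.
apply/existsP; exists [ffun v => Ordinal (gP v)].
have gD u v : u != v -> d < `|g u - g v|.
  move=> uv; rewrite /g !PoszM -GRing.mulrBr abszM absz_nat leq_pmulr //.
  by rewrite lt0n distn_eq0 (inj_eq val_inj) (inj_eq enum_rank_inj).
apply/forallP => u; apply/forallP => v; rewrite !ffunE /=.
have [<-|/gD guv] := eqVneq u v; last first.
  by rewrite (ltnW guv) (leq_ltn_trans _ guv) ?implybT.
rewrite adj_irrefl /=; apply/implyP => /andP[_ /forallP /(_ ord0)] /negP[].
by apply/existsP; exists [tuple]; rewrite /= eqxx.
Qed.

Definition lambda_d1 (d : nat) (G : sgraph) : nat :=
  ex_minn (has_Ld1_labeling_ex G d).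

(* Main.v *)
Require Import Defs.
From mathcomp Require Import all_boot all_order all_algebra.
From mathcomp Require Import zify ring.
Import GRing.Theory.

(** Upper bound: with s = 2d + 3, label (i, j) by (alpha i + beta j) mod s, where
    up to sign {alpha, beta} = {d, d + 1} in Z/s.  The differences along edges
    then lie in {d, ..., d + 3}, so they are at least d also after reduction, and
    no two steps cancel unless they are inverse to each other.  The labeling is
    compatible with the twist as soon as beta l = alpha m mod s, and each of
    (a)-(d) provides suitable alpha and beta.

    Lower bound: the neighbours of a vertex have distinct labels.  If every vertex
    has degree at least 4 and all labels are at most 2d + 1, counting the labels
    at distance at least d from a given one shows that only those in
    [0, d - 2] and [d + 3, 2d + 1] can occur; a vertex labeled in one interval has
    all its neighbours labeled in the other one, whose size is d - 1 < 4. *)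

(** * Walks and distance two *)

Lemma walk0 (G : sgraph) (u : G) : walk 0 u u.
Proof. by apply/existsP; exists [tuple]; rewrite /= eqxx. Qed.

Lemma walk1 (G : sgraph) (u v : G) : walk 1 u v = adj u v.
Proof.
apply/existsP/idP => [[p]|uv]; last by exists [tuple v]; rewrite /= uv eqxx.
by case/tupleP: p => x p; rewrite [p]tuple0 /= andbT => /andP[xu /eqP <-].
Qed.

Lemma walk2P (G : sgraph) (u v : G) :
  reflect (exists2 w, adj u w & adj w v) (walk 2 u v).
Proof.
apply: (iffP existsP) => [[p]|[w uw wv]]; last first.
  by exists [tuple w; v]; rewrite /= uw wv eqxx.
case/tupleP: p => w p; case/tupleP: p => x p.
by rewrite [p]tuple0 /= andbT => /andP[/andP[uw wx] /eqP <-]; exists w.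
Qed.

Lemma at_distance2P (G : sgraph) (u v : G) :
  reflect [/\ exists2 w, adj u w & adj w v, u != v & ~~ adj u v]
          (at_distance 2 u v).
Proof.
apply: (iffP andP) => [[/walk2P uwv /forallP nw]|[uwv nuv auv]]; split.
- by [].
- by apply: contraNneq (nw ord0) => <-; exact: walk0.
- by have := nw ord_max; rewrite walk1.
- exact/walk2P.
apply/forallP => -[[|[|//]] lt_i2] /=; last by rewrite walk1.
apply: contra nuv => /existsP[p]; by rewrite [p]tuple0 /= => /eqP->.
Qed.

(** * Lower bound by counting labels around a vertex *)

Section LowerBound.

Variables (G : sgraph) (d : nat) (f : G -> nat).
Hypotheses (d_gt0 : 0 < d) (f_lab : Ld1_labeling d f).

Lemma Ld1_labeling_adj (u v : G) : adj u v -> d <= `|f u - f v|.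
Proof.
by move=> uv; have /forallP/(_ u)/forallP/(_ v)/andP[/implyP/(_ uv)] := f_lab.
Qed.

(** Distinct neighbours of [u] are adjacent or at distance 2; either way their labels differ, since
    [d] is positive. *)
Lemma Ld1_labeling_neighbours_inj (u : G) : {in adj u &, injective f}.
Proof.
move=> v w uv uw fvw; apply/eqP/negPn/negP => nvw.
have [/Ld1_labeling_adj|nadj] := boolP (adj v w).
  by rewrite fvw distnn leqNgt d_gt0.
have vw2 : at_distance 2 v w.
  by apply/at_distance2P; split=> //; exists u; rewrite // adj_sym.
have /forallP/(_ v)/forallP/(_ w)/andP[_ /implyP/(_ vw2)] := f_lab.
by rewrite fvw distnn.
Qed.

(** [P] records which labels are still possible, so that the count can be run a second time on the
    survivors of the first. *)
Definition far_labels (d k : nat) (P : pred nat) (x : nat) : seq nat :=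
  [seq y <- iota 0 k | P y && (d <= `|x - y|)].

Lemma Ld1_labeling_degree (k : nat) (P : pred nat) (u : G) :
  (forall v, f v < k) -> (forall v, P (f v)) ->
  #|adj u| <= size (far_labels d k P (f u)).
Proof.
move=> f_lt fP; rewrite cardE -(size_map f (enum _)).
apply: uniq_leq_size => [|y /mapP[v]]; rewrite ?map_inj_in_uniq ?enum_uniq //.
  by move=> v w; rewrite !mem_enum; apply: Ld1_labeling_neighbours_inj.
rewrite mem_enum => uv ->.
by rewrite mem_filter fP Ld1_labeling_adj // mem_iota f_lt.
Qed.

End LowerBound.

Lemma has_Ld1_labeling_min (G : sgraph) (d k : nat) (u : G) :
  1 <= d <= 4 -> (forall v : G, 4 <= #|adj v|) ->
  has_Ld1_labeling G d k -> 2 * d + 2 <= k.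
Proof.
move=> /andP[d1 d4] deg4 /existsP[f f_lab]; rewrite leqNgt; apply/negP => ltk.
have f_lt v : f v < 2 * d + 2 by apply: leq_trans ltk.
(* The first count shows that every label in use satisfies [P]; the second, restricted to [P], finds
   too few labels for four neighbours. *)
pose P x := 4 <= size (far_labels d (2 * d + 2) predT x).
have fP v : P (f v).
  apply: leq_trans (deg4 v) _.
  exact: (Ld1_labeling_degree _ _ _ d1 f_lab _ predT v f_lt).
have := leq_trans (deg4 u) (Ld1_labeling_degree _ _ _ d1 f_lab _ P u f_lt fP).
have : all (fun x => size (far_labels d (2 * d + 2) P x) < 4)
           (iota 0 (2 * d + 2)).
  (* A finite computation for each [d] from 1 to 4. *)
  by rewrite /P; case: d d1 d4 {f_lab f_lt fP ltk P} => [|[|[|[|[|]]]]].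
by move/allP/(_ (f u)); rewrite mem_iota f_lt => /(_ isT) lt4; rewrite leqNgt lt4.
Qed.

(** * Labelings that change by a fixed residue along each of two steps *)

Lemma two_shift_labeling (G : sgraph) (a b : G -> G) (F : G -> nat)
    (d alpha beta : nat) :
  1 <= d -> injective a -> injective b ->
  (forall u v, adj u v -> [\/ v = a u, u = a v, v = b u | u = b v]) ->
  (beta = d /\ (alpha = d + 1 \/ alpha = d + 2) \/
   beta = d + 1 /\ (alpha = d \/ alpha = d + 3)) ->
  (forall u, F u < 2 * d + 3) ->
  (forall u, F (a u) = F u + beta %[mod 2 * d + 3]) ->
  (forall u, F (b u) = F u + alpha %[mod 2 * d + 3]) ->
  has_Ld1_labeling G d (2 * d + 2).
Proof.
move=> d1 a_inj b_inj adjP ab F_lt Fa Fb.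
(* A sum of two residues wraps around at most once, so the congruences become linear
   alternatives. *)
have shiftP x y c : x < 2 * d + 3 -> y < 2 * d + 3 -> c < 2 * d + 3 ->
    y = x + c %[mod 2 * d + 3] -> y = x + c \/ y + (2 * d + 3) = x + c.
  move=> ltx lty ltc; rewrite (modn_small lty) => ->.
  have [lt|le] := ltnP (x + c) (2 * d + 3); first by left; rewrite modn_small.
  right; rewrite -{1}(subnK le) modnDr modn_small; lia.
have {}Fa u : F (a u) = F u + beta \/ F (a u) + (2 * d + 3) = F u + beta.
  by apply: shiftP => //; lia.
have {}Fb u : F (b u) = F u + alpha \/ F (b u) + (2 * d + 3) = F u + alpha.
  by apply: shiftP => //; lia.
have F_lt1 u : F u < (2 * d + 2).+1 by have := F_lt u; lia.
apply/existsP; exists [ffun u => Ordinal (F_lt1 u)].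
apply/forallP => u; apply/forallP => v; rewrite !ffunE /=.
apply/andP; split; apply/implyP.
  move=> uv; have := F_lt u; have := F_lt v.
  by case: (adjP u v uv) => ->; [have := Fa u | have := Fa v
                               | have := Fb u | have := Fb v]; lia.
case/at_distance2P => -[w /adjP uw /adjP wv] nuv _.
have := F_lt u; have := F_lt v; have := F_lt w.
have := Fa u; have := Fa v; have := Fa w.
have := Fb u; have := Fb v; have := Fb w.
(* Two steps change the label by a nonzero residue unless the second undoes the first; these four
   cases remain, and there [u = v]. *)
case: uw wv => e1 [] e2; have := congr1 F e1; have := congr1 F e2; try lia.
- by rewrite (a_inj u v) ?eqxx in nuv => //; rewrite -e1 -e2.
- by rewrite e1 e2 eqxx in nuv.
- by rewrite (b_inj u v) ?eqxx in nuv => //; rewrite -e1 -e2.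
- by rewrite e1 e2 eqxx in nuv.
Qed.

(** * Cyclic shifts and the structure of the bundle *)

Lemma cyclic_shift_inj (n l : nat) : injective (@cyclic_shift n l).
Proof.
move=> i j /(congr1 val) /= /eqP; rewrite eqn_modDr !modn_small // => /eqP.
exact: val_inj.
Qed.

Lemma val_cyclic_shift1 (n : nat) (i : 'I_n) :
  cyclic_shift 1 i = (if i.+1 < n then i.+1 else 0) :> nat.
Proof.
have lt_in := ltn_ord i; rewrite /= addn1.
case: ltnP => [/modn_small // | le_ni].
by have -> : i.+1 = n; rewrite ?modnn //; apply/eqP; rewrite eqn_leq lt_in.
Qed.

Lemma cycle_edgeE (n : nat) (i j : 'I_n) :
  cycle_edge i j = (i == cyclic_shift 1 j) || (j == cyclic_shift 1 i).
Proof.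
rewrite /cycle_edge [i + 1 == j %[mod n]]eq_sym.
by rewrite !(modn_small (ltn_ord _)) -!val_eqE.
Qed.

Section Bundle.

Variables (m n l : nat).
Hypotheses (m_gt2 : 2 < m) (n_gt2 : 2 < n).

Let G : sgraph := cycle_bundle m (@cyclic_shift n l).

(** This and [base_step] are the permutations [a] and [b] to which [two_shift_labeling] is
    applied. *)
Definition fibre_step (u : 'I_m * 'I_n) : 'I_m * 'I_n :=
  (u.1, cyclic_shift 1 u.2).

Definition base_step (u : 'I_m * 'I_n) : 'I_m * 'I_n :=
  (cyclic_shift 1 u.1, if u.1.+1 < m then u.2 else cyclic_shift l u.2).

Lemma fibre_step_inj : injective fibre_step.
Proof. by case=> [i j] [i' j'] /pair_equal_spec[/= -> /cyclic_shift_inj ->]. Qed.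

Lemma base_step_inj : injective base_step.
Proof.
case=> [i j] [i' j'] /pair_equal_spec[/= /cyclic_shift_inj <-].
by case: ifP => _ => [-> | /cyclic_shift_inj ->].
Qed.

Lemma cyclic_shift1_neq k (i : 'I_k) : 1 < k -> cyclic_shift 1 i != i.
Proof.
move=> k1; rewrite -(inj_eq (@ord_inj k)) val_cyclic_shift1.
by have := ltn_ord i; case: (ltnP i.+1 k); lia.
Qed.

Lemma cyclic_shift11_neq k (i : 'I_k) :
  2 < k -> cyclic_shift 1 (cyclic_shift 1 i) != i.
Proof.
move=> k2; rewrite -(inj_eq (@ord_inj k)) !val_cyclic_shift1; move: (ltn_ord i).
by case: (ltnP i.+1 k) => ? ?; case: ltnP; lia.
Qed.

Lemma bundle_edgeE (u v : 'I_m * 'I_n) :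
  bundle_edge (@cyclic_shift n l) u v =
  [|| v == fibre_step u, u == fibre_step v | v == base_step u].
Proof.
case: u v => [i j] [i' j']; rewrite /bundle_edge /= /simple_rel !cycle_edgeE.
rewrite /fibre_step /base_step /= !xpair_eqE [RHS]orbA; congr (_ || _).
  rewrite (eq_sym i'); case: (i == i') => //=.
  rewrite [(j' == _) || (j == _)]orbC orbb andb_idl // => /orP[]/eqP->.
    by rewrite cyclic_shift1_neq // ltnW.
  by rewrite eq_sym cyclic_shift1_neq // ltnW.
rewrite -(inj_eq (@ord_inj m) i') val_cyclic_shift1.
have lti' := ltn_ord i'; case: ltnP => lti.
  have -> : (i == m.-1 :> nat) = false by lia.
  by rewrite orbF (eq_sym i.+1) (eq_sym j).
have -> : (i.+1 == i' :> nat) = false by lia.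
by have -> : (i == m.-1 :> nat) by have := ltn_ord i; lia.
Qed.

Lemma adj_bundle (u v : G) :
  adj u v = [|| v == fibre_step u, u == fibre_step v, v == base_step u
              | u == base_step v].
Proof.
rewrite /= /simple_rel !bundle_edgeE.
have [<-|] := eqVneq u v; last by do 4 case: (_ == _).
rewrite /= !orbb; case: u => i j; rewrite /fibre_step /base_step !xpair_eqE /=.
by rewrite eqxx ![i == _]eq_sym ![j == cyclic_shift 1 j]eq_sym;
  rewrite !(negPf (cyclic_shift1_neq _ _ _)) // ltnW.
Qed.

(** Fibre steps keep the first coordinate and base steps change it; forward and backward steps
    differ because both cycles have length at least 3. *)
Lemma bundle_degree (u : G) : 4 <= #|adj u|.
Proof.
pose v := [:: fibre_step u; invF fibre_step_inj u; base_step u;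
              invF base_step_inj u].
suff v_uniq : uniq v.
  rewrite -[4]/(size v) -(card_uniqP v_uniq) subset_leq_card //.
  apply/subsetP => w w_v; rewrite [_ \in _]adj_bundle.
  by move: w_v; rewrite !inE => /or4P[]/eqP->; rewrite ?f_invF eqxx ?orbT.
have fE : fibre_step (invF fibre_step_inj u) = u by exact: f_invF.
have bE : base_step (invF base_step_inj u) = u by exact: f_invF.
rewrite {}/v.
move: (invF fibre_step_inj u) (invF base_step_inj u) fE bE => p q fE bE.
have p1 : p.1 = u.1 by rewrite -[in RHS]fE.
have q1 : q.1 != u.1.
  by rewrite -[in X in _ != X]bE eq_sym cyclic_shift1_neq // ltnW.
have b1 : (base_step u).1 != u.1 by rewrite cyclic_shift1_neq // ltnW.
rewrite /= !inE !negb_or !andbT; apply/and3P; split; first (apply/and3P; split).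
- apply/eqP => /(congr1 fibre_step); rewrite fE => /(congr1 snd) /= /eqP.
  by rewrite (negPf (cyclic_shift11_neq _ _ _)).
- by apply: contraNneq b1 => <-.
- by apply: contraNneq q1 => <-.
- by apply/andP; split; [apply: contraNneq b1 | apply: contraNneq q1] => <-;
    rewrite p1.
- apply/eqP => /(congr1 base_step); rewrite bE => /(congr1 fst) /= /eqP.
  by rewrite (negPf (cyclic_shift11_neq _ _ _)).
Qed.

(** Wrapping around a fibre is harmless because [2 * d + 3] divides [n]. Returning from the last
    fibre to the first adds [beta * l] and drops [alpha * (m - 1)], which is a net change of [alpha]
    by the congruence. *)
Lemma bundle_labeling (d alpha beta : nat) :
  1 <= d -> 2 * d + 3 %| n ->
  (beta = d /\ (alpha = d + 1 \/ alpha = d + 2) \/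
   beta = d + 1 /\ (alpha = d \/ alpha = d + 3)) ->
  beta * l = alpha * m %[mod 2 * d + 3] ->
  has_Ld1_labeling G d (2 * d + 2).
Proof.
move=> d1 dvd_sn ab compat.
pose F (u : G) := (alpha * u.1 + beta * u.2) %% (2 * d + 3).
apply: (@two_shift_labeling G fibre_step base_step F d alpha beta) => //.
- exact: fibre_step_inj.
- exact: base_step_inj.
- by move=> u v; rewrite adj_bundle => /or4P[]/eqP; constructor.
- by move=> u; rewrite ltn_pmod // addn3.
- move=> [i j]; rewrite /F /= modn_mod modnDml -addnA -modnDmr -modnMmr.
  by rewrite (modn_dvdm _ dvd_sn) modnMmr modnDmr mulnDr muln1.
- move=> [i j]; rewrite /F modn_mod modnDml val_cyclic_shift1 /=.
  have lti := ltn_ord i; case: (ltnP i.+1 m) => lei /=.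
    by congr (_ %% _); lia.
  have {lti lei} mE : m = i.+1 by lia.
  have amE : alpha * m = alpha * i + alpha by rewrite addnC -mulnS {1}mE.
  rewrite muln0 add0n -modnMmr (modn_dvdm _ dvd_sn) modnMmr mulnDr.
  by rewrite -modnDmr compat modnDmr amE addnCA addnA.
Qed.

End Bundle.

(** * Congruences over the integers and the four families of shifts *)

Local Open Scope ring_scope.

Lemma modz_of_dvdn (l n s : nat) (x : int) :
  (s %| n)%N -> l%:Z = (x %% n%:Z)%Z -> exists q : int, l%:Z = x + q * s%:Z.
Proof.
move=> /dvdnP[c ->] ->; exists (- (x %/ (c * s)%N%:Z)%Z * c%:Z).
by rewrite {2}(divz_eq x (c * s)%N%:Z) PoszM; ring.
Qed.

Lemma eqn_mod_of_int (x y s : nat) (q : int) :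
  x%:Z = y%:Z + q * s%:Z -> x = y %[mod s]%N.
Proof.
by move=> e; apply/eqP; rewrite -eqz_nat -!modz_nat e addrC modzMDl.
Qed.

Theorem theorem2 (d m s n l : nat)
  (hd : (1 <= d)%N) (hm : (3 <= m)%N) (hs : s = (2 * d + 3)%N)
  (hn : (0 < n)%N) (hsn : (s %| n)%N) (hl : (l < n)%N)
  (hyp :
    (* (a) *)
    (exists (a : nat) (k : int),
       (a = 1%N \/ a = 2%N) /\
       l%:Z = ((k * s%:Z + (-1) ^+ a * (2 * d%:Z * m%:Z)) %% n%:Z)%Z)
    \/
    (* (b) *)
    (exists t : nat, d = (3 * t + 2)%N /\
     exists (a : nat) (k : int),
       (a = 1%N \/ a = 2%N) /\
       l%:Z = ((k * s%:Z - (2 * t%:Z + 3) * (d%:Z + a%:Z) * m%:Z) %% n%:Z)%Z)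
    \/
    (* (c) *)
    (exists t : nat, d = (3 * t + 1)%N /\
     exists (a : nat) (k : int),
       (a = 1%N \/ a = 2%N) /\
       l%:Z = ((k * s%:Z + (2 * t%:Z + 1) * (d%:Z + a%:Z) * m%:Z) %% n%:Z)%Z)
    \/
    (* (d) *)
    (exists t : nat, (1 <= t)%N /\ d = (3 * t)%N /\
     exists p t' : nat, m = (p * s + 3 * t')%N /\ (t' <= 2 * t)%N /\
     exists (a r : nat) (k : int),
       (a = 1%N \/ a = 2%N) /\ (r = 0%N \/ r = 1%N \/ r = 2%N) /\
       l%:Z = ((k * s%:Z + (r%:Z + a%:Z - 1) * (s%:Z %/ 3)%Z
                - (-1) ^+ a * t'%:Z) %% n%:Z)%Z)) :
  (lambda_d1 d (cycle_bundle m (@cyclic_shift n l)) <= 2 * d + 2)%N /\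
  ((1 <= d <= 4)%N ->
   lambda_d1 d (cycle_bundle m (@cyclic_shift n l)) = (2 * d + 2)%N).
Proof.
have n_gt2 : (2 < n)%N.
  by apply: leq_trans (dvdn_leq hn hsn); rewrite hs addn3.
have lab : has_Ld1_labeling (cycle_bundle m (@cyclic_shift n l)) d (2 * d + 2).
  suff [alpha [beta [q [ab e]]]] : exists (alpha beta : nat) (q : int),
      (beta = d /\ (alpha = d + 1 \/ alpha = d + 2) \/
       beta = d + 1 /\ (alpha = d \/ alpha = d + 3))%N /\
      beta%:Z * l%:Z = alpha%:Z * m%:Z + q * s%:Z.
    apply: (bundle_labeling _ _ _ hm n_gt2 _ alpha beta hd _ ab).
      by rewrite -hs.
    by rewrite -hs; apply: (eqn_mod_of_int _ _ _ q); rewrite !PoszM.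
  subst s.
  case: hyp => [[a [k [ha /(modz_of_dvdn _ _ _ _ hsn)[q ->]]]]|
    [[t [hdt [a [k [ha /(modz_of_dvdn _ _ _ _ hsn)[q ->]]]]]]|
    [[t [hdt [a [k [ha /(modz_of_dvdn _ _ _ _ hsn)[q ->]]]]]]|
    [t [t1 [hdt [p [t' [hmt [ht' [a [r [k
      [ha [hr /(modz_of_dvdn _ _ _ _ hsn)[q ->]]]]]]]]]]]]]]]].
  (* Modulo [s], [2 * (d + 1)] is -1, so [beta * l] is [d * m] for [a = 1] and [- d * m], that is
     [(d + 3) * m], for [a = 2]. *)
  - exists (if a == 1%N then d else d + 3)%N, (d + 1)%N.
    exists ((d%:Z + 1) * (k + q) + (if a == 1%N then - d%:Z else d%:Z - 1) * m%:Z).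
    by case: ha => ->; (split; first by auto); 
      rewrite /= ?expr1 ?sqrrN ?expr1n; ring.
  (* Here [d * (2 * t + 3) = (t + 1) * s - 1], so [-(2 * t + 3)] inverts [d] modulo [s]. *)
  - exists (d + a)%N, d, (d%:Z * (k + q) - (d%:Z + a%:Z) * m%:Z * (t%:Z + 1)).
    split; first by case: ha => ->; auto.
    by rewrite hdt; ring.
  (* Here [d * (2 * t + 1) = t * s + 1], so [2 * t + 1] inverts [d] modulo [s]. *)
  - exists (d + a)%N, d, (d%:Z * (k + q) + (d%:Z + a%:Z) * m%:Z * t%:Z).
    split; first by case: ha => ->; auto.
    by rewrite hdt; ring.
  - have -> : ((2 * d + 3)%N%:Z %/ 3)%Z = 2 * t%:Z + 1.
      have -> : (2 * d + 3)%N%:Z = (2 * t%:Z + 1) * 3.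
        by rewrite hdt; ring.
      by rewrite mulzK.
    (* Now 3 divides both [d] and [s], and [d] kills the multiples of [s / 3] modulo [s]. The rest
       matches since [3 * (d + a)] is [d] for [a = 1] and [- d] for [a = 2], modulo [s]. *)
    exists (d + a)%N, d, (d%:Z * (k + q) + (r%:Z + a%:Z - 1) * t%:Z
      - (d%:Z + a%:Z) * p%:Z - a%:Z * t'%:Z).
    split; first by case: ha => ->; auto.
    by case: ha => ->; rewrite hmt hdt ?expr1 ?sqrrN ?expr1n; ring.
rewrite /lambda_d1; case: ex_minnP => k hk /(_ _ lab) le_k; split=> // d14.
have u : cycle_bundle m (@cyclic_shift n l).
  exact: (Ordinal (ltnW (ltnW hm)), Ordinal hn).
apply/eqP; rewrite eqn_leq le_k.
exact: has_Ld1_labeling_min u d14 (bundle_degree _ _ _ hm n_gt2) hk.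
Qed.
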